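(* Let $p,q>1$. Then $$\arccos_{p,q}(x)=x^{p-1}(1-x^p)^{1/q}\,{}_2F_1\!\left(1,\,1+\tfrac1q-\tfrac1p;\;1+\tfrac1q;\;1-x^p\right),\qquad 0\le x\le 1,$$ (where at $x=0$ the right-hand side is understood as its limit as $x\to0^+$), and $$\operatorname{arccosh}_{p,q}(x)=\frac1x\,(x^p-1)^{1/q}\,{}_2F_1\!\left(1,\,\tfrac1p;\;1+\tfrac1q;\;1-x^{-p}\right),\qquad 1\le x<\infty.$$
   Context: Let $p,q>1$. ${}_2F_1(a,b;c;z)$ is the Gauss hypergeometric function. $\arcsin_{p,q}(x)=\int_0^x (1-t^q)^{-1/p}\,dt$ for $x\in[0,1]$; $\pi_{p,q}/2=\arcsin_{p,q}(1)$; $\sin_{p,q}:[0,\pi_{p,q}/2]\to[0,1]$ is its inverse; $\cos_{p,q}(y)=\frac{d}{dy}\sin_{p,q}(y)=(1-\sin_{p,q}^q(y))^{1/p}$ on $[0,\pi_{p,q}/2]$; and $\arccos_{p,q}:[0,1]\to[0,\pi_{p,q}/2]$ is the inverse of $\cos_{p,q}$ on this interval, that is, $\arccos_{p,q}(x)=\arcsin_{p,q}\big((1-x^p)^{1/q}\big)=\frac pq\int_x^1(1-u^p)^{1/q-1}u^{p-2}\,du$. $\operatorname{arcsinh}_{p,q}(x)=\int_0^x(1+t^q)^{-1/p}\,dt$ for $x\ge0$; $\sinh_{p,q}$ is its inverse; $\cosh_{p,q}(y)=\frac{d}{dy}\sinh_{p,q}(y)=(1+\sinh_{p,q}^q(y))^{1/p}$;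 and $\operatorname{arccosh}_{p,q}$ is the inverse of $\cosh_{p,q}$, that is, $\operatorname{arccosh}_{p,q}(x)=\operatorname{arcsinh}_{p,q}\big((x^p-1)^{1/q}\big)=\frac pq\int_1^x(u^p-1)^{1/q-1}u^{p-2}\,du$ for $1\le x<\infty$. *)

(* Defs.v *)
From HB Require Import structures.
From mathcomp Require Import all_boot all_order all_algebra.
From mathcomp Require Import all_classical all_reals all_analysis.

Set Implicit Arguments.
Unset Strict Implicit.
Unset Printing Implicit Defensive.

Import Order.TTheory GRing.Theory Num.Theory.
Import numFieldNormedType.Exports.

Local Open Scope classical_set_scope.
Local Open Scope ring_scope.

(* Derivative of f at y relative to D; it is one-sided at an endpoint of an
   interval D. *)
Definition derive_within (R : realType) (D : set R) (f : R -> R) (y : R) : R :=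
  lim ((f z - f y) / (z - y) @[z --> within D y^']).

Definition pochhammer (R : realType) (a : R) (n : nat) : R :=
  \prod_(k < n) (a + k%:R).

Definition gauss_coef (R : realType) (a b c : R) (n : nat) : R :=
  pochhammer a n * pochhammer b n / (pochhammer c n * n`!%:R).

(* Gauss hypergeometric function as the sum of its power series: meaningful
   for `|z| < 1 and c not in {0, -1, -2, ...}. *)
Definition hyp2F1 (R : realType) (a b c z : R) : R :=
  limn (pseries (gauss_coef a b c) z).

Section generalized_trigonometric.
Variables (R : realType) (p q : R).

(* Lebesgue integral: for x = 1 the integrand is unbounded near t = 1.
   At t = 1 itself, powR gives 0 `^ (- p^-1) = 0, on a null set. *)
Definition arcsin_pq (x : R) : R :=
  \int[lebesgue_measure]_(t in `[0, x]) ((1 - t `^ q) `^ (- p^-1)).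

Definition pi_pq : R := 2 * arcsin_pq 1.

Definition sin_pq : R -> R := pinv (`[0, 1] : set R) arcsin_pq.

Definition cos_pq : R -> R := derive_within (`[0, pi_pq / 2]) sin_pq.

Definition arccos_pq : R -> R := pinv (`[0, pi_pq / 2] : set R) cos_pq.

Definition arcsinh_pq (x : R) : R :=
  \int[lebesgue_measure]_(t in `[0, x]) ((1 + t `^ q) `^ (- p^-1)).

(* This range is bounded when q > p, unbounded otherwise. *)
Definition sinh_pq_dom : set R := arcsinh_pq @` `[0, +oo[.

Definition sinh_pq : R -> R := pinv (`[0, +oo[ : set R) arcsinh_pq.

Definition cosh_pq : R -> R := derive_within sinh_pq_dom sinh_pq.

Definition arccosh_pq : R -> R := pinv sinh_pq_dom cosh_pq.

End generalized_trigonometric.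

(* Main.v *)
Require Import Defs.
From mathcomp Require Import all_boot all_order all_algebra.
From mathcomp Require Import all_classical all_reals all_analysis.
From mathcomp Require Import measurable_realfun ring lra.
Import Order.TTheory GRing.Theory Num.Theory.
Import numFieldNormedType.Exports.
Local Open Scope classical_set_scope.
Local Open Scope ring_scope.
Set Implicit Arguments.
Unset Strict Implicit.
Unset Printing Implicit Defensive.

(** Both inverse functions are incomplete beta integrals, and the
    hypergeometric series of the statement sums such an integral in closed
    form.

    Fix [0 < b <= 1 + g] and let [F z] be the sum of the series
    [2F1 (1, b; 1 + g; z)].  Its coefficients [c n = (b)_n / (1 + g)_n] satisfy
    the two-term recurrence [(1 + g + n) c_(n+1) = (b + n) c_n], which says that
    [F] solves the first-order equation
    [z (1 - z) F' + (g - b z) F = g] on the unit disc ([hyp2F1_ode]).  This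
    equation is exactly what makes
    [Phi w = w^g (1 - w)^(b - g) F w] a primitive of
    [g w^(g - 1) (1 - w)^(b - g - 1)] on [0 < w < 1]
    ([is_derive_beta_prim]).  The substitution [w = t^q], with [g = 1/q] and
    [b = 1 + 1/q - 1/p], turns this integrand into [(1 - t^q)^(-1/p)]; the
    substitution [w = t^q / (1 + t^q)], with [g = 1/q] and [b = 1/p], turns it
    into [(1 + t^q)^(-1/p)].  Hence closed forms for the generalized arcsine on
    [0 <= s < 1] ([arcsin_beta_prim]) and for the generalized hyperbolic
    arcsine ([arcsinh_beta_prim]).

    The other half is that the inverse cosines, defined as inverses of the
    derivative of an inverse function, are what they should be.  If [A] is
    the primitive of a positive [f], each secant slope of [A^-1] is
    a value of [1/f] at an intermediate point, by the mean value theorem; so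
    the derivative of [A^-1] at [A s] is [1/f s], one-sided at endpoints, and
    also at an endpoint where [f] blows up, provided that [1/f] extends
    continuously ([derive_within_pinv]).  Therefore the inverse of this
    derivative sends [1/f s] to [A s] ([pinv_derive_within_primitive]), that
    is, [arccos ((1 - s^q)^(1/p)) = arcsin s] and
    [arccosh ((1 + s^q)^(1/p)) = arcsinh s].  It remains to put
    [s = (1 - x^p)^(1/q)], resp. [s = (x^p - 1)^(1/q)].  The limit at
    [x = 0] is the left continuity of the arcsine at [1], which follows from
    the integrability of [(1 - t^q)^(-1/p)] up to [1]. *)

(** * Real powers *)

Lemma powR_lt1 (R : realType) (r x : R) : 0 < r -> 0 <= x -> x < 1 -> x `^ r < 1.
Proof.
by move=> r0 x0 x1; have := gt0_ltr_powR r0 _ _ x1; rewrite powR1 !nnegrE; apply.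
Qed.

Lemma powR_le1 (R : realType) (r x : R) : 0 < r -> 0 <= x -> x <= 1 -> x `^ r <= 1.
Proof.
move=> r0 x0 x1.
have := ge0_ler_powR (ltW r0) _ _ x1; rewrite powR1 !nnegrE x0 ler01; exact.
Qed.

Lemma powR_pred (R : realType) (x r : R) : 0 < x -> x `^ r = x * x `^ (r - 1).
Proof.
move=> x0; rewrite -{2}[x](powRr1 (ltW x0)) -powRD ?(gt_eqF x0) ?implybT//.
by rewrite addrC subrK.
Qed.

Lemma is_derive_powR_onem (R : realType) (r t : R) : t < 1 ->
  is_derive t 1 (fun x : R => (1 - x) `^ r) (- (r * (1 - t) `^ (r - 1))).
Proof.
move=> t1; have t1' : 0 < 1 - t by rewrite subr_gt0.
have dB : is_derive t 1 (fun x : R => 1 - x) (- 1).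
  by have := is_deriveB (is_derive_cst (1 : R) t 1) (is_derive_id t 1); rewrite sub0r.
by have := @is_derive1_comp _ (fun x : R => x `^ r) (fun x : R => 1 - x) t _ _
  (is_derive1_powR r t1') dB; rewrite mulrN1.
Qed.

Lemma continuous_powR_comp (R : realType) (f : R -> R) (r x : R) :
  {for x, continuous f} -> 0 < f x -> {for x, continuous (fun y => f y `^ r)}.
Proof.
move=> cf fx0; apply: (@continuous_comp _ _ _ f (fun y : R => y `^ r)) => //.
apply: differentiable_continuous; apply/derivable1_diffP.
by case: (is_derive1_powR r fx0).
Qed.

(** [x `^ r] is [1] for [x < 0], so that it is discontinuous at [0].  The
    absolute value gives a function that agrees with it on [0 <= x] and is
    continuous everywhere, which spares one-sided limits at [0]. *)
Lemma continuous_norm_powR (R : realType) (r : R) : 0 < r ->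
  continuous (fun x : R => `|x| `^ r).
Proof.
move=> r0 x; have [->|x0] := eqVneq x 0; last first.
  apply: continuous_powR_comp; last by rewrite normr_gt0.
  exact: norm_continuous.
apply/cvgrPdist_lt => e e0 /=; near=> y.
rewrite normr0 powR0 ?gt_eqF// sub0r normrN ger0_norm ?powR_ge0//.
have yd : `|y| < e `^ r^-1.
  near: y; exists (e `^ r^-1) => /=; first exact: powR_gt0.
  by move=> y /=; rewrite sub0r normrN.
have := gt0_ltr_powR r0 _ _ yd; rewrite !nnegrE normr_ge0 powR_ge0.
by rewrite -powRrM mulVf ?gt_eqF// powRr1 ?(ltW e0)//; apply.
Unshelve. all: by end_near. Qed.

Lemma continuous_norm_comp_powR (R : realType) (f : R -> R) (r : R) : 0 < r ->
  continuous f -> continuous (fun x : R => `|f x| `^ r).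
Proof.
move=> r0 cf x; apply: (@continuous_comp _ _ _ f (fun y : R => `|y| `^ r)).
  exact: cf.
exact: continuous_norm_powR.
Qed.

(** * The differential equation of the hypergeometric series *)

(** The left-hand side is one term of the binomial expansion of the right-hand
    side. *)
Lemma mulrSn_exp_le (R : realType) (k e : R) (n : nat) : 0 <= k -> 0 <= e ->
  n.+1%:R * k ^+ n * e <= (k + e) ^+ n.+1.
Proof.
move=> k0 e0; elim: n => [|n IH]; first by rewrite expr0 expr1; lra.
rewrite [leRHS]exprS; apply: (@le_trans _ _ (k * (n.+1%:R * k ^+ n * e) + e * k ^+ n.+1)).
  by rewrite [n.+2%:R]mulrS exprS; lra.
rewrite mulrDl lerD// ler_wpM2l// lerXn2r// ?nnegrE; lra.
Qed.

(** Shrinking the radius absorbs the factor [n + 1] of the differentiated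
    series: with [e] half the gap between the radii, [mulrSn_exp_le] bounds
    its terms by [1 / e] times those of the original series at [`|x| + e]. *)
Lemma is_cvg_pseries_diffs (R : realType) (c : R^nat) (r x : R) :
  cvgn (pseries c r) -> `|x| < `|r| -> cvgn (pseries (pseries_diffs c) x).
Proof.
move=> cr xr; pose e := (`|r| - `|x|) / 2.
have e0 : 0 < e by rewrite /e; lra.
have xe : `| `|x| + e| < `|r|.
  by rewrite ger0_norm ?addr_ge0// ?ltW// /e; lra.
have {}cr := is_cvg_pseries_inside_norm cr xe.
apply: normed_cvg.
apply: (@series_le_cvg _ _
  (fun n => e^-1 * (`|c n.+1| * (`|x| + e) ^+ n.+1))) => [n|n|n|].
- exact: normr_ge0.
- by rewrite /= !mulr_ge0 ?invr_ge0 ?exprn_ge0 ?addr_ge0// ltW.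
- rewrite /= /pseries_diffs !normrM normrX ger0_norm// [leRHS]mulrC.
  rewrite ler_pdivlMr//.
  rewrite (mulrC n.+1%:R) -2!mulrA [X in _ * X]mulrA.
  by rewrite ler_wpM2l// mulrSn_exp_le// ltW.
- apply: (@is_cvg_seriesZ _ (fun n => `|c n.+1| * (`|x| + e) ^+ n.+1) e^-1).
  move: cr; rewrite /pseries -(is_cvg_series_restrict 1).
  move=> /cvg_ex[l] /=; rewrite -cvg_shiftS/= => cl.
  apply/cvg_ex; exists l; apply: cvg_trans cl.
  apply: near_eq_cvg; near=> n; rewrite /series/=.
  by rewrite big_add1.
Unshelve. all: by end_near. Qed.

(** Term-by-term differentiation ([pseries_snd_diffs]) asks for convergence of
    the series and of its first two formal derivatives at one common point;
    the points [s < t] between [`|x|] and [`|r|] leave room for two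
    differentiations. *)
Lemma is_derive_pseries (R : realType) (c : R^nat) (r x : R) :
  cvgn (pseries c r) -> `|x| < `|r| ->
  is_derive x 1 (fun z => limn (pseries c z)) (limn (pseries (pseries_diffs c) x)).
Proof.
move=> cr xr; pose s := (2 * `|x| + `|r|) / 3; pose t := (`|x| + 2 * `|r|) / 3.
have := normr_ge0 x => x0.
have s0 : `|s| = s by rewrite ger0_norm// /s; lra.
have t0 : `|t| = t by rewrite ger0_norm// /t; lra.
have st : `|s| < `|t| by rewrite s0 t0 /s /t; lra.
have tr : `|t| < `|r| by rewrite t0 /t; lra.
have xs : `|x| < `|s| by rewrite s0 /s; lra.
apply: (@pseries_snd_diffs _ _ s) => //.
- exact: is_cvg_pseries_inside cr (lt_trans st tr).
- exact: is_cvg_pseries_diffs cr (lt_trans st tr).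
- exact: is_cvg_pseries_diffs (is_cvg_pseries_diffs cr tr) st.
Qed.

Lemma pochhammerS (R : realType) (a : R) n :
  pochhammer a n.+1 = pochhammer a n * (a + n%:R).
Proof. by rewrite /pochhammer big_ord_recr. Qed.

Lemma pochhammer_gt0 (R : realType) (a : R) n : 0 < a -> 0 < pochhammer a n.
Proof. by move=> a0; apply: prodr_gt0 => i _; rewrite ltr_wpDr. Qed.

Lemma pochhammer1 (R : realType) n : pochhammer (1 : R) n = n`!%:R.
Proof.
elim: n => [|n IH]; first by rewrite /pochhammer big_ord0.
by rewrite pochhammerS IH factS natrM mulrC -natr1 addrC.
Qed.

Lemma gauss_coef1E (R : realType) (b c : R) n :
  gauss_coef 1 b c n = pochhammer b n / pochhammer c n.
Proof.
by rewrite /gauss_coef pochhammer1 [_%:R * _]mulrC -mulf_div divff ?mulr1.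
Qed.

Lemma gauss_coef1S (R : realType) (b c : R) n : 0 < c ->
  (c + n%:R) * gauss_coef 1 b c n.+1 = (b + n%:R) * gauss_coef 1 b c n.
Proof.
move=> c0; rewrite !gauss_coef1E !pochhammerS.
have : pochhammer c n != 0 by rewrite gt_eqF// pochhammer_gt0.
have : c + n%:R != 0 by rewrite gt_eqF// ltr_wpDr.
by move=> ? ?; field; apply/andP.
Qed.

(** Each factor [(b + k) / (c + k)] of the coefficient is at most [1]. *)
Lemma gauss_coef1_bound (R : realType) (b c : R) n : 0 < b -> b <= c ->
  `|gauss_coef 1 b c n| <= 1.
Proof.
move=> b0 bc; have c0 := lt_le_trans b0 bc.
rewrite gauss_coef1E ger0_norm ?divr_ge0 ?(ltW (pochhammer_gt0 _ _))//.
rewrite ler_pdivrMr ?pochhammer_gt0// mul1r ler_prod// => i _.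
by rewrite addr_ge0 ?(ltW b0)//= lerD2r.
Qed.

Lemma is_cvg_hyp2F1 (R : realType) (b c z : R) : 0 < b -> b <= c -> `|z| < 1 ->
  cvgn (pseries (gauss_coef 1 b c) z).
Proof.
move=> b0 bc z1; apply: normed_cvg; apply: (series_le_cvg (v_ := geometric 1 `|z|)).
- by move=> n; apply: normr_ge0.
- by move=> n /=; rewrite mul1r exprn_ge0.
- move=> n /=; rewrite normrM normrX ler_wpM2r ?exprn_ge0//.
  exact: gauss_coef1_bound.
- by apply: is_cvg_geometric_series; rewrite normr_id.
Qed.

(** By the recurrence on the coefficients, the left-hand side evaluated on
    partial sums telescopes: it equals [g] minus
    [c n * z ^+ n * (g + n%:R * z)], and this remainder tends to [0] because
    it is made of general terms of the series and of its derivative. *)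
Lemma hyp2F1_ode (R : realType) (b g z : R) : 0 < b -> b <= 1 + g -> `|z| < 1 ->
  exists2 dF : R, is_derive z 1 (hyp2F1 1 b (1 + g)) dF
    & z * (1 - z) * dF + (g - b * z) * hyp2F1 1 b (1 + g) z = g.
Proof.
move=> b0 bg z1; set c := gauss_coef 1 b (1 + g).
have [r zr r1] : exists2 r : R, `|z| < `|r| & `|r| < 1.
  have z0 := normr_ge0 z.
  by exists ((1 + `|z|) / 2); rewrite [`|_ / _|]ger0_norm; lra.
have cr := is_cvg_hyp2F1 b0 bg r1.
have cF := is_cvg_pseries_inside cr zr.
have cD := is_cvg_pseries_diffs cr zr.
exists (limn (pseries (pseries_diffs c) z)).
  exact: is_derive_pseries cr zr.
rewrite /hyp2F1 -/c; set D : R := limn _; set F : R := limn _.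
pose T n := c n * z ^+ n * (g + n%:R * z).
have E n : z * (1 - z) * pseries (pseries_diffs c) z n
    + (g - b * z) * pseries c z n = g - T n.
  elim: n => [|n IH].
    rewrite /pseries /series/= !big_geq// /T /c gauss_coef1E /pochhammer.
    by rewrite !big_ord0 expr0 !mulr0 mul0r !addr0 divr1 !mul1r subrr.
  have rec : (1 + g + n%:R) * c n.+1 = (b + n%:R) * c n.
    by apply: gauss_coef1S; lra.
  move: IH; rewrite /pseries /series/= !big_nat_recr//=.
  set s1 : R := \sum_(_ <= _ < _) _; set s2 : R := \sum_(_ <= _ < _) _ => IH.
  rewrite /T /pseries_diffs -[n.+1%:R]natr1 exprSr -/c in IH rec *.
  have -> : z * (1 - z) * (s1 + (n%:R + 1) * c n.+1 * z ^+ n)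
      + (g - b * z) * (s2 + c n * z ^+ n)
    = z * (1 - z) * s1 + (g - b * z) * s2
      + (z * (1 - z) * ((n%:R + 1) * c n.+1) + (g - b * z) * c n) * z ^+ n by ring.
  rewrite IH.
  have bE : b * c n = (1 + g + n%:R) * c n.+1 - n%:R * c n by rewrite rec; ring.
  have -> : (g - b * z) * c n = g * c n - z * (b * c n) by ring.
  rewrite bE; ring.
(* The shift by one exhibits [n * c n * z ^+ n] as [z] times a term of the
   differentiated series. *)
have T0 : T n @[n --> \oo] --> 0.
  rewrite -cvg_shiftS.
  have -> : [sequence T n.+1]_n =
      (fun n => g * (c n.+1 * z ^+ n.+1) + z * z * (pseries_diffs c n * z ^+ n)).
    by apply/funext => n; rewrite /= /T /pseries_diffs exprS; ring.
  have e0 : g * 0 + z * z * 0 = 0 by rewrite !mulr0 addr0.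
  suff : g * (c n.+1 * z ^+ n.+1) + z * z * (pseries_diffs c n * z ^+ n)
      @[n --> \oo] --> g * 0 + z * z * 0 by rewrite e0.
  apply: cvgD; apply: cvgM; try exact: cvg_cst.
    by rewrite (cvg_shiftS (fun n => c n * z ^+ n)); exact: cvg_series_cvg_0.
  exact: cvg_series_cvg_0.
have L1 : z * (1 - z) * pseries (pseries_diffs c) z n
    + (g - b * z) * pseries c z n @[n --> \oo] --> z * (1 - z) * D + (g - b * z) * F.
  by apply: cvgD; apply: cvgM => //; exact: cvg_cst.
have L2 : g - T n @[n --> \oo] --> g.
  by rewrite -[X in _ --> X]subr0; apply: cvgB => //; exact: cvg_cst.
rewrite (funext E) in L1; exact: cvg_unique L1 L2.
Qed.

(** * A primitive of the beta integrand *)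

(** The incomplete beta integral of [g * u `^ (g - 1) * (1 - u) `^ (b - g - 1)]
    over [0 <= u <= w], for [0 <= w < 1]. *)
Definition beta_prim (R : realType) (b g w : R) : R :=
  w `^ g * (1 - w) `^ (b - g) * hyp2F1 1 b (1 + g) w.

(** After division by [w `^ (g - 1) * (1 - w) `^ (b - g - 1)], the product rule
    gives the left-hand side of [hyp2F1_ode]. *)
Lemma is_derive_beta_prim (R : realType) (b g w : R) :
  0 < b -> b <= 1 + g -> 0 < w < 1 ->
  is_derive w 1 (beta_prim b g) (g * w `^ (g - 1) * (1 - w) `^ (b - g - 1)).
Proof.
move=> b0 bg /andP[w0 w1].
have w1' : 0 < 1 - w by rewrite subr_gt0.
have [dF dFw ode] : exists2 dF : R, is_derive w 1 (hyp2F1 1 b (1 + g)) dF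
    & w * (1 - w) * dF + (g - b * w) * hyp2F1 1 b (1 + g) w = g.
  by apply: hyp2F1_ode => //; rewrite ger0_norm// ltW.
have d1 : is_derive w 1 (fun x => (1 - x) `^ (b - g))
    (- ((b - g) * (1 - w) `^ (b - g - 1))) by exact: is_derive_powR_onem.
have := is_deriveM (is_deriveM (is_derive1_powR g w0) d1) dFw.
move/is_derive_eq; apply; rewrite /GRing.scale/= !fctE.
rewrite (powR_pred g w0) (powR_pred (b - g) w1').
set P := w `^ _; set Q := (1 - w) `^ _; set F : R := hyp2F1 _ _ _ _.
have -> : g * P * Q = (w * (1 - w) * dF + (g - b * w) * F) * P * Q by rewrite ode.
ring.
Qed.

Lemma beta_prim_cvg0 (R : realType) (b g : R) (w : R -> R) :
  0 < b -> b <= 1 + g -> 0 < g -> (\forall x \near 0^'+, 0 < w x) ->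
  w x @[x --> 0^'+] --> 0 ->
  beta_prim b g (w x) @[x --> 0^'+] --> 0.
Proof.
move=> b0 bg g0 wpos w0.
have wr : w x @[x --> 0^'+] --> 0^'+.
  by move=> P P0; apply: filterS2 wpos (w0 _ P0) => x wx; apply.
have c1 : (w x) `^ g @[x --> 0^'+] --> 0 by apply: cvg_comp wr (powR_cvg0 g0).
have [dF dF0 _] : exists2 dF : R, is_derive (0 : R) 1 (hyp2F1 1 b (1 + g)) dF
    & 0 * (1 - 0) * dF + (g - b * 0) * hyp2F1 1 b (1 + g) 0 = g.
  by apply: hyp2F1_ode => //; rewrite normr0.
have c2 : hyp2F1 1 b (1 + g) (w x) @[x --> 0^'+] --> hyp2F1 1 b (1 + g) 0.
  apply: (cvg_comp _ _ w0); apply: differentiable_continuous.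
  by apply/derivable1_diffP; case: dF0.
have c3 : (1 - w x) `^ (b - g) @[x --> 0^'+] --> (1 : R) `^ (b - g).
  have w1 : 1 - w x @[x --> 0^'+] --> (1 : R).
    by rewrite -[X in _ --> X]subr0; apply: cvgB => //; exact: cvg_cst.
  have c : {for (1 : R), continuous (fun y : R => y `^ (b - g))}.
    apply: differentiable_continuous; apply/derivable1_diffP.
    by case: (is_derive1_powR (b - g) (ltr01 : 0 < (1 : R))).
  exact: (cvg_comp _ _ w1 c).
have := cvgM (cvgM c1 c3) c2.
by rewrite !mul0r; apply.
Qed.

(** Change of variable [u = w t] in the incomplete beta integral, by the chain
    rule and the fundamental theorem of calculus.  The formula for [f] is asked
    for at [0 < x] because its powers are singular at [w x = 0] in general;
    at [0] only one-sided continuity of the primitive is needed. *)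
Lemma Rintegral_beta_prim (R : realType) (b g s : R) (f w dw : R -> R) :
  0 < b -> b <= 1 + g -> 0 < g -> 0 < s ->
  {within `[0, s], continuous f} ->
  (forall x, 0 < x <= s -> [/\ 0 < w x < 1, is_derive x 1 w (dw x)
    & f x = g * w x `^ (g - 1) * (1 - w x) `^ (b - g - 1) * dw x]) ->
  w x @[x --> 0^'+] --> 0 -> w 0 = 0 ->
  \int[lebesgue_measure]_(t in `[0, s]) f t = beta_prim b g (w s).
Proof.
move=> b0 bg g0 s0 cf wP w0 w00.
have d x : 0 < x <= s -> is_derive x 1 (beta_prim b g \o w) (f x).
  move=> /wP[wx dwx ->]; apply: is_derive1_comp dwx.
  exact: is_derive_beta_prim.
rewrite /Rintegral (@continuous_FTC2 _ f (beta_prim b g \o w) 0 s)//.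
- by rewrite /= w00 /beta_prim powR0 ?gt_eqF// !mul0r subr0.
- split.
  + move=> x; rewrite in_itv/= => /andP[x0 xs].
    by have [] : is_derive x 1 (beta_prim b g \o w) (f x) by apply: d; rewrite x0 ltW.
  + rewrite /= w00 {2}/beta_prim powR0 ?gt_eqF// !mul0r.
    apply: beta_prim_cvg0 => //.
    near=> x; have [|/andP[]//] := wP x.
    by apply/andP; split => //; near: x; exact: nbhs_right_le.
  + apply: cvg_at_left_filter; apply: differentiable_continuous.
    apply/derivable1_diffP.
    by have [] : is_derive s 1 (beta_prim b g \o w) (f s) by apply: d; rewrite s0 lexx.
- move=> x; rewrite in_itv/= => /andP[x0 xs].
  have dx : is_derive x 1 (beta_prim b g \o w) (f x) by apply: d; rewrite x0 ltW.
  by rewrite derive1E derive_val.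
Unshelve. all: by end_near. Qed.

(** * Derivative of an inverse function within its domain *)

(** [k] plays the role of the derivative of the inverse of [A]: the hypothesis
    [secant] is the conclusion of the mean value theorem, written for the
    inverse function.  This form makes no reference to the derivative of [A],
    which may be infinite at an endpoint of [I]. *)
Section inverse_derivative.
Variables (R : realType) (I : set R) (A k : R -> R).
Hypothesis itvI : is_interval I.
Hypothesis contA :
  forall u v, I u -> I v -> u < v -> {within `[u, v], continuous A}.
Hypothesis secant : forall u v, I u -> I v -> u < v ->
  exists2 c, u < c < v & 0 < k c /\ v - u = k c * (A v - A u).

Lemma secant_lt u v : I u -> I v -> u < v -> A u < A v.
Proof.
move=> Iu Iv uv; have [c _ [kc0 E]] := secant Iu Iv uv.
by rewrite -subr_gt0 -(pmulr_rgt0 _ kc0) -E subr_gt0.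
Qed.

Lemma secant_inj : {in I &, injective A}.
Proof.
move=> u v /set_mem Iu /set_mem Iv Auv.
have [uv|vu|//] := ltgtP u v.
  by have := secant_lt Iu Iv uv; rewrite Auv ltxx.
by have := secant_lt Iv Iu vu; rewrite Auv ltxx.
Qed.

(** A strictly increasing function on an interval has a continuous inverse
    because, on each side of [s], either the point at distance [d] is in [I]
    and its image gives [e], or all of [I] on that side is at distance less
    than [d]. *)
Lemma secant_inverse_continuous s (d : R) : I s -> 0 < d ->
  exists2 e : R, 0 < e & forall v, I v -> `|A v - A s| < e -> `|v - s| < d.
Proof.
move=> Is d0.
have [e1 e10 H1] : exists2 e : R, 0 < e &
    forall v, I v -> A v - A s < e -> v - s < d.
  have [Isd|nI] := pselect (I (s + d)).
    exists (A (s + d) - A s); first by rewrite subr_gt0 secant_lt ?ltrDl.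
    move=> v Iv; rewrite ltrD2r ltrBlDl; apply: contraTT; rewrite -!leNgt.
    rewrite le_eqVlt => /predU1P[->//|sdv].
    exact/ltW/secant_lt.
  exists 1 => // v Iv _; rewrite ltrBlDl ltNge; apply/negP => sdv.
  by apply: nI; apply: (itvI Is Iv); rewrite sdv lerDl ltW.
have [e2 e20 H2] : exists2 e : R, 0 < e &
    forall v, I v -> A s - A v < e -> s - v < d.
  have [Isd|nI] := pselect (I (s - d)).
    exists (A s - A (s - d)); first by rewrite subr_gt0 secant_lt ?gtrBl.
    move=> v Iv; rewrite ltrD2l ltrN2 ltrBlDl -ltrBlDr; apply: contraTT; rewrite -!leNgt.
    rewrite le_eqVlt => /predU1P[->//|sdv].
    exact/ltW/secant_lt.
  exists 1 => // v Iv _; rewrite ltrBlDl -ltrBlDr ltNge; apply/negP => sdv.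
  by apply: nI; apply: (itvI Iv Is); rewrite sdv gerBl ltW.
exists (Num.min e1 e2) => [|v Iv]; first by rewrite lt_min e10.
rewrite lt_min !ltr_norml => /andP[/andP[a1 a2] /andP[a3 a4]].
have := H1 _ Iv a2; have := H2 v Iv; lra.
Qed.

(** The limit that defines a derivative within a set is determined only if the
    filter is proper.  Here it is, by the intermediate value theorem: the image
    contains a nontrivial segment ending at [A s]. *)
Lemma secant_image_limit_point s t : I s -> I t -> s != t ->
  ProperFilter (within (A @` I) (A s)^').
Proof.
move=> Is It st; apply: Build_ProperFilter_ex => P.
rewrite /within/= => -[e /= e0 H].
have seg u v : I u -> I v -> u < v -> forall y, A u <= y <= A v -> (A @` I) y.
  move=> Iu Iv uv y yuv.
  have [x /= xuv <-] : (A @` `[u, v]) y.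
    apply: (segment_continuous_le_surjective (ltW uv) _ (contA Iu Iv uv)) => //.
    exact/ltW/secant_lt.
  exists x => //; apply: (itvI Iu Iv).
  by move: xuv; rewrite in_itv.
have [slt|tls|E] := ltgtP s t; last by rewrite E eqxx in st.
- have Ast := secant_lt Is It slt.
  pose y := Num.min (A s + e / 2) (A t).
  have ys : A s < y by rewrite lt_min Ast andbT; lra.
  exists y; apply: H => /=; last 2 first.
  + by rewrite gt_eqF.
  + by apply: (seg _ _ Is It slt); rewrite (ltW ys) ge_min lexx orbT.
  + rewrite ltr0_norm ?subr_lt0//.
    have : y <= A s + e / 2 by rewrite ge_min lexx.
    lra.
- have Ast := secant_lt It Is tls.
  pose y := Num.max (A s - e / 2) (A t).
  have ys : y < A s by rewrite gt_max Ast andbT; lra.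
  exists y; apply: H => /=; last 2 first.
  + by rewrite lt_eqF.
  + by apply: (seg _ _ It Is tls); rewrite (ltW ys) le_max lexx orbT.
  + rewrite gtr0_norm ?subr_gt0//.
    have : A s - e / 2 <= y by rewrite le_max lexx.
    lra.
Qed.

(** Each difference quotient of the inverse is a value [k c] with [c] between
    [s] and a point that tends to [s]. *)
Lemma derive_within_pinv s t : I s -> I t -> s != t -> {for s, continuous k} ->
  derive_within (A @` I) (pinv I A) (A s) = k s.
Proof.
move=> Is It st ks.
have pF := secant_image_limit_point Is It st.
have gK u : I u -> pinv I A (A u) = u.
  by move=> Iu; apply: pinvKV; [exact: secant_inj|exact/mem_set].
apply: cvg_lim => //; apply/cvgrPdist_lt => e e0.
have /cvgrPdist_lt/(_ _ e0)[d /= d0 Hd] := ks.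
have [h h0 Hh] := secant_inverse_continuous Is d0.
rewrite /within/=; exists h => //= z zs zne [v Iv zE]; subst z.
rewrite !gK//.
have vs : `|v - s| < d by apply: Hh => //; rewrite distrC.
suff [c cs ->] : exists2 c, `|c - s| < d & (v - s) / (A v - A s) = k c.
  by apply: Hd; rewrite /= distrC.
have [sv|lvs|E] := ltgtP s v.
- have [c /andP[sc cv] [_ E]] := secant Is Iv sv.
  exists c; first by move: vs; rewrite !gtr0_norm ?subr_gt0//; lra.
  by rewrite E mulfK// subr_eq0 gt_eqF// secant_lt.
- have [c /andP[sc cv] [_ E]] := secant Iv Is lvs.
  exists c; first by move: vs; rewrite !ltr0_norm ?subr_lt0//; lra.
  by rewrite -[v - s]opprB E -mulrN opprB mulfK// subr_eq0 lt_eqF// secant_lt.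
- by rewrite E eqxx in zne.
Qed.

Lemma pinv_derive_within_pinv : (exists u v, [/\ I u, I v & u != v]) ->
  (forall s, I s -> {for s, continuous k}) ->
  {in I &, injective k} -> forall s, I s ->
  pinv (A @` I) (derive_within (A @` I) (pinv I A)) (k s) = A s.
Proof.
move=> [u [v [Iu Iv uv]]] ck kinj s Is.
have dE w : I w -> derive_within (A @` I) (pinv I A) (A w) = k w.
  move=> Iw; have [E|wu] := eqVneq w u; last exact: derive_within_pinv wu (ck _ Iw).
  by rewrite -E in uv; apply: derive_within_pinv uv (ck _ Iw).
rewrite -(dE s Is) pinvKV//; last by apply/mem_set; exists s.
move=> y z /set_mem[a Ia <-] /set_mem[b Ib <-]; rewrite !dE// => ab.
by rewrite (kinj a b)//; apply/mem_set.
Qed.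

End inverse_derivative.

(** * Primitives of positive functions *)

(** The continuity of [f] is stated on the open interval because [f] may be
    unbounded near [v], as the arcsine integrand is near [1]. *)
Lemma Rintegral_mean_value (R : realType) (f : R -> R) (u v : R) :
  0 <= u -> u < v ->
  (@lebesgue_measure R).-integrable `[0, v] (EFin \o f) ->
  (forall x, 0 < x < v -> {for x, continuous f}) ->
  let A x := \int[lebesgue_measure]_(t in `[0, x]) f t in
  {within `[u, v], continuous A} /\
  exists2 c, u < c < v & A v - A u = f c * (v - u).
Proof.
move=> u0 uv intf cf A.
have cA : {within `[u, v], continuous A}.
  apply: (@continuous_subspaceW _ _ `[u, v]%classic `[0, v]%classic).
    by move=> x /=; rewrite !in_itv/= => /andP[ux ->]; rewrite (le_trans u0).
  by apply: parameterized_integral_continuous intf; rewrite (le_trans u0)// ltW.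
split => //.
have [|//|c cuv ->] := @MVT _ A f u v uv _ _; last first.
- by exists c; rewrite // in_itv/= in cuv *.
- move=> x; rewrite in_itv/= => /andP[ux xv].
  have x0 := le_lt_trans u0 ux.
  have cfx : {for x, continuous f} by apply: cf; rewrite x0.
  have [dA <-] := continuous_FTC1_closed xv intf x0 cfx.
  by rewrite derive1E; exact: derivableP.
Qed.

(** Monotone convergence along the segments [[a, b - 1 / n]]; the end point [b]
    is a null set. *)
Lemma ge0_integrable_bound (R : realType) (f : R -> R) (a b B : R) :
  measurable_fun setT f -> (forall x, 0 <= f x) ->
  (forall c, c < b ->
    (\int[lebesgue_measure]_(x in `[a, c]) (f x)%:E <= B%:E)%E) ->
  (@lebesgue_measure R).-integrable `[a, b] (EFin \o f).
Proof.
move=> mf f0 fB.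
apply/integrableP; split; first exact/measurable_EFinP/measurable_funTS.
under eq_integral do rewrite /= ger0_norm//.
rewrite -integral_itv_bndo_bndc; last first.
  exact/measurable_EFinP/measurable_funTS.
rewrite itv_bnd_open_bigcup.
apply: (@le_lt_trans _ _ B%:E); last exact: ltry.
pose S n : set R := `[a, b - n.+1%:R^-1]%classic.
have cv : (\int[lebesgue_measure]_(x in S n) (f x)%:E)%E @[n --> \oo] -->
    (\int[lebesgue_measure]_(x in \bigcup_n S n) (f x)%:E)%E.
  apply: ge0_nondecreasing_set_cvg_integral.
  - move=> n m nm; apply/subsetPset => x; rewrite /S/= !in_itv/= => /andP[-> xb].
    by apply: le_trans xb _; rewrite lerD2l lerN2 lef_pV2 ?posrE// ler_nat.
  - by move=> n; exact: measurable_itv.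
  - by move=> n; exact/measurable_EFinP/measurable_funTS.
  - by move=> *; rewrite lee_fin.
rewrite -(cvg_lim _ cv)//; apply: lime_le; first exact: cvgP cv.
by apply: nearW => n; apply: fB; rewrite ltrBlDr ltrDl.
Qed.

(** With [k = 1 / f] and [A] the primitive of [f], the double inversion on the
    left is how the inverse cosine is built from the arcsine: [pinv I A] is
    the sine, its derivative is the cosine. *)
Lemma pinv_derive_within_primitive (R : realType) (I : set R) (f k : R -> R) :
  is_interval I -> (forall v, I v -> 0 <= v) ->
  (exists u v, [/\ I u, I v & u != v]) ->
  (forall v, I v -> (@lebesgue_measure R).-integrable `[0, v] (EFin \o f)) ->
  (forall v x, I v -> 0 < x < v ->
    [/\ {for x, continuous f}, 0 < k x & k x * f x = 1]) ->
  continuous k -> {in I &, injective k} ->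
  let A x := \int[lebesgue_measure]_(t in `[0, x]) f t in
  forall s, I s ->
  pinv (A @` I) (derive_within (A @` I) (pinv I A)) (k s) = A s.
Proof.
move=> itvI I0 I2 intf fk ck kinj A s Is.
have MV u v : I u -> I v -> u < v -> {within `[u, v], continuous A} /\
    exists2 c, u < c < v & A v - A u = f c * (v - u).
  move=> Iu Iv uv; apply: Rintegral_mean_value (I0 _ Iu) uv (intf _ Iv) _.
  by move=> x xv; have [] := fk v x Iv xv.
apply: pinv_derive_within_pinv => //.
- by move=> u v Iu Iv uv; have [] := MV u v Iu Iv uv.
- move=> u v Iu Iv uv; have [_ [c /andP[uc cv] E]] := MV u v Iu Iv uv.
  have [|_ kc0 kf] := fk v c Iv; first by rewrite cv (le_lt_trans (I0 _ Iu)).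
  by exists c; rewrite ?uc// E mulrA kf mul1r.
- by move=> v _; exact: ck.
Qed.

(** * The generalized arcsine and arccosine *)

Section arcsine.
Variables (R : realType) (p q : R).
Hypotheses (hp : 1 < p) (hq : 1 < q).

Let p0 : 0 < p. Proof. exact: lt_trans hp. Qed.
Let q0 : 0 < q. Proof. exact: lt_trans hq. Qed.
Let ip0 : 0 < p^-1. Proof. by rewrite invr_gt0. Qed.
Let iq0 : 0 < q^-1. Proof. by rewrite invr_gt0. Qed.
Let ip1 : p^-1 < 1. Proof. by rewrite invf_lt1. Qed.

Lemma arcsin_integrand_within (s : R) : s < 1 ->
  {within `[0, s], continuous (fun t => (1 - t `^ q) `^ (- p^-1))}.
Proof.
move=> s1.
apply: (@subspace_eq_continuous _ _ _ (fun t => (1 - `|t| `^ q) `^ (- p^-1))).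
  by move=> t /set_mem/=; rewrite in_itv/= => /andP[t0 _]; rewrite ger0_norm.
apply: continuous_in_subspaceT => t /set_mem/=; rewrite in_itv/= => /andP[t0 ts].
apply: (@continuous_powR_comp _ (fun t : R => 1 - `|t| `^ q) (- p^-1) t).
  by apply: cvgB; [exact: cvg_cst|exact: continuous_norm_powR].
by rewrite subr_gt0 powR_lt1// ger0_norm// (le_lt_trans ts).
Qed.

Lemma arcsin_beta_prim (s : R) : 0 <= s -> s < 1 ->
  arcsin_pq p q s = beta_prim (1 + q^-1 - p^-1) q^-1 (s `^ q).
Proof.
rewrite le_eqVlt => /predU1P[<- _|s0 s1]; rewrite /arcsin_pq.
  by rewrite set_itv1 Rintegral_set1 powR0 ?gt_eqF// /beta_prim powR0 ?gt_eqF// !mul0r.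
apply: (@Rintegral_beta_prim _ _ _ _ _ (fun x => x `^ q)
  (fun x => q * x `^ (q - 1))) => //.
- by have := iq0; have := ip1; lra.
- by rewrite gerBl ltW.
- exact: arcsin_integrand_within.
- move=> x /andP[x0 xs]; have x1 := le_lt_trans xs s1; split.
  + by rewrite powR_gt0// powR_lt1// ltW.
  + exact: is_derive1_powR.
  + have -> : 1 + q^-1 - p^-1 - q^-1 - 1 = - p^-1 by ring.
    have e : q^-1 * (x `^ q) `^ (q^-1 - 1) * (q * x `^ (q - 1)) = 1.
      rewrite mulrACA mulVf ?gt_eqF// mul1r -powRrM mulrBr mulr1 divff ?gt_eqF//.
      by rewrite -powRD ?(gt_eqF x0) ?implybT// addrA subrK subrr powRr0.
    by rewrite mulrAC e mul1r.
- exact: powR_cvg0.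
- by rewrite powR0 ?gt_eqF.
Qed.

(** Since [t `^ q <= t] on the unit interval, the integrand is at most
    [(1 - t) `^ (- p^-1)], whose primitive is explicit and bounded because
    [p^-1 < 1]. *)
Lemma arcsin_integrable :
  (@lebesgue_measure R).-integrable `[0, 1] (EFin \o (fun t => (1 - t `^ q) `^ (- p^-1))).
Proof.
have mf : measurable_fun [set: R] (fun t : R => (1 - t `^ q) `^ (- p^-1)).
  apply: (measurableT_comp (measurable_powR _)).
  by apply: measurable_funB => //; exact: measurable_powR.
(* The constant is the integral of (1 - t) ^ (- 1 / p) over [0, 1]. *)
apply: (@ge0_integrable_bound _ _ _ _ (1 - p^-1)^-1) => //.
  by move=> x; exact: powR_ge0.
move=> c c1; have [c0|c0] := leP c 0.
  rewrite (@le_trans _ _ 0%E) ?lee_fin ?invr_ge0 ?subr_ge0 ?(ltW ip1)//.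
  move: c0; rewrite le_eqVlt => /predU1P[->|c0].
    by rewrite set_itv1 integral_set1.
  by rewrite set_itv_ge ?integral_set0// -leNgt bnd_simp.
pose h (t : R) := (1 - t) `^ (- p^-1).
pose H (t : R) := - ((1 - p^-1)^-1 * (1 - t) `^ (1 - p^-1)).
have r0 : 0 < 1 - p^-1 by rewrite subr_gt0.
have dH (t : R) : t < 1 -> is_derive t 1 H (h t).
  move=> t1.
  have := is_deriveZ (- (1 - p^-1)^-1) (is_derive_powR_onem (1 - p^-1) t1).
  have -> : - (1 - p^-1)^-1 \*: (fun x : R => (1 - x) `^ (1 - p^-1)) = H.
    by apply/funext => x; rewrite /H /= -mulNr.
  move/is_derive_eq; apply; rewrite /GRing.scale/= mulrNN mulrA mulVf ?gt_eqF//.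
  by rewrite mul1r /h; congr (_ `^ _); ring.
have cH (t : R) : t < 1 -> {for t, continuous H}.
  by move=> /dH[d _]; apply: differentiable_continuous; exact/derivable1_diffP.
have ch : {within `[0, c], continuous h}.
  apply: continuous_in_subspaceT => t /set_mem/=; rewrite in_itv/= => /andP[t0 ts].
  apply: (@continuous_powR_comp _ (fun t : R => 1 - t) (- p^-1) t); last first.
    by rewrite subr_gt0 (le_lt_trans ts).
  by apply: cvgB; [exact: cvg_cst|exact: cvg_id].
have hB : (\int[lebesgue_measure]_(x in `[0%R, c]) (h x)%:E <= ((1 - p^-1)^-1)%:E)%E.
  rewrite (@continuous_FTC2 _ h H 0 c c0)//.
  - rewrite -EFinB lee_fin /H subr0 powR1 mulr1 opprK gerDr oppr_le0.
    by rewrite mulr_ge0 ?powR_ge0// invr_ge0 ltW.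
  - split.
    + move=> t; rewrite in_itv/= => /andP[_ tc].
      by have [] := dH t (lt_trans tc c1).
    + by apply: cvg_at_right_filter; exact: cH.
    + by apply: cvg_at_left_filter; exact: cH.
  - move=> t; rewrite in_itv/= => /andP[_ tc].
    have ? := dH t (lt_trans tc c1).
    by rewrite derive1E derive_val.
apply: le_trans hB.
apply: ge0_le_integral => //=.
- by move=> x _; rewrite lee_fin powR_ge0.
- exact/measurable_EFinP/measurable_funTS.
- apply/measurable_EFinP/measurable_funTS.
  apply: (measurableT_comp (measurable_powR _)).
  exact: measurable_funB.
- move=> x; rewrite in_itv/= => /andP[x0 xc]; rewrite lee_fin.
  have x1 := le_lt_trans xc c1.
  have xq : x `^ q <= x.
    move: x0; rewrite le_eqVlt => /predU1P[<-|x0]; first by rewrite powR0 ?gt_eqF.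
    by rewrite ge1r_powR ?x0 ?ltW.
  have xq1 := le_lt_trans xq x1.
  rewrite /h !powRN lef_pV2 ?posrE ?powR_gt0 ?subr_gt0//.
  by apply: (ge0_ler_powR (ltW ip0)); rewrite ?nnegrE ?lerD2l ?lerN2// subr_ge0 ltW.
Qed.

Lemma arcsin0 : arcsin_pq p q 0 = 0.
Proof. by rewrite /arcsin_pq set_itv1 Rintegral_set1. Qed.

Lemma arcsin_continuous : {within `[0, 1], continuous (arcsin_pq p q)}.
Proof. exact: parameterized_integral_continuous ler01 arcsin_integrable. Qed.

Lemma arcsin_cvg1 : arcsin_pq p q s @[s --> 1^'-] --> arcsin_pq p q 1.
Proof. exact: parameterized_integral_cvg_at_left ltr01 arcsin_integrable. Qed.

Lemma arcsin_integrableW (v : R) : v <= 1 ->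
  (@lebesgue_measure R).-integrable `[0, v]
    (EFin \o (fun t => (1 - t `^ q) `^ (- p^-1))).
Proof.
move=> v1; apply: integrableS arcsin_integrable => //.
by move=> t /=; rewrite !in_itv/= => /andP[-> tv]; rewrite (le_trans tv).
Qed.

Lemma arcsin_integrand_continuous (x : R) : 0 < x < 1 ->
  {for x, continuous (fun t => (1 - t `^ q) `^ (- p^-1))}.
Proof.
move=> /andP[x0 x1]; apply: continuous_powR_comp; last first.
  by rewrite subr_gt0 powR_lt1// ltW.
apply: cvgB; first exact: cvg_cst.
exact: (@continuous_powR_comp _ id).
Qed.

Lemma arcsin_le (u v : R) : 0 <= u -> u <= v -> v <= 1 ->
  arcsin_pq p q u <= arcsin_pq p q v.
Proof.
move=> u0; rewrite le_eqVlt => /predU1P[->//|uv] v1.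
have [|_ [c _ E]] := Rintegral_mean_value u0 uv (arcsin_integrableW v1).
  move=> x /andP[x0 xv].
  by apply: arcsin_integrand_continuous; rewrite x0 (lt_le_trans xv).
by rewrite -subr_ge0 /arcsin_pq E mulr_ge0 ?powR_ge0// subr_ge0 ltW.
Qed.

Lemma arcsin_image :
  (`[0, pi_pq p q / 2]%classic : set R) = arcsin_pq p q @` `[0, 1].
Proof.
have -> : pi_pq p q / 2 = arcsin_pq p q 1 by rewrite /pi_pq mulrAC divff ?mul1r.
apply/seteqP; split => [y /= y01|_ [x /= + <-]].
  apply: (segment_continuous_le_surjective ler01 _ arcsin_continuous); last first.
    by rewrite /= arcsin0.
  exact: arcsin_le.
by rewrite !in_itv/= => /andP[x0 x1]; rewrite -{1}arcsin0 !arcsin_le.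
Qed.

Lemma arccosE (s : R) : 0 <= s <= 1 ->
  arccos_pq p q ((1 - s `^ q) `^ (p^-1)) = arcsin_pq p q s.
Proof.
(* An everywhere continuous extension of the reciprocal of the integrand,
   equal to 0 at the endpoint 1. *)
have [k ck kE] : exists2 k : R -> R, continuous k &
    forall x, 0 <= x <= 1 -> k x = (1 - x `^ q) `^ (p^-1).
  exists (fun x => `|1 - `|x| `^ q| `^ (p^-1)) => [|x /andP[x0 x1]].
    apply: continuous_norm_comp_powR => // x.
    by apply: cvgB; [exact: cvg_cst|exact: continuous_norm_powR].
  by rewrite (ger0_norm x0) ger0_norm// subr_ge0 powR_le1.
move=> s01; rewrite -kE// /arccos_pq /cos_pq arcsin_image.
apply: (@pinv_derive_within_primitive _ `[0, 1]%classic
  (fun t => (1 - t `^ q) `^ (- p^-1)) k) => //.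
- exact: interval_is_interval.
- by move=> v /=; rewrite in_itv/= => /andP[].
- by exists 0, 1; rewrite /= !in_itv/= !lexx ler01 eq_sym oner_neq0.
- by move=> v /=; rewrite in_itv/= => /andP[_]; exact: arcsin_integrableW.
- move=> v x; rewrite /= in_itv/= => /andP[v0 v1] /andP[x0 xv].
  have x1 := lt_le_trans xv v1.
  have xq : 0 < 1 - x `^ q by rewrite subr_gt0 powR_lt1// ltW.
  rewrite kE ?(ltW x0) ?(ltW x1)//; split.
  + by apply: arcsin_integrand_continuous; rewrite x0.
  + exact: powR_gt0.
  + by rewrite powRN divff// gt_eqF// powR_gt0.
- move=> x y /set_mem/=; rewrite in_itv/= => x01 /set_mem/=; rewrite in_itv/= => y01.
  rewrite (kE x x01) (kE y y01); move: x01 y01 => /andP[x0 x1] /andP[y0 y1].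
  move/(powR_injective ip0); rewrite !nnegrE !subr_ge0 !powR_le1// => /(_ isT isT).
  move/addrI/oppr_inj/(powR_injective q0); rewrite !nnegrE; exact.
Qed.

End arcsine.

(** * The generalized hyperbolic arcsine and arccosine *)

Section arcsinh.
Variables (R : realType) (p q : R).
Hypotheses (hp : 1 < p) (hq : 1 < q).

Let p0 : 0 < p. Proof. exact: lt_trans hp. Qed.
Let q0 : 0 < q. Proof. exact: lt_trans hq. Qed.
Let ip0 : 0 < p^-1. Proof. by rewrite invr_gt0. Qed.
Let iq0 : 0 < q^-1. Proof. by rewrite invr_gt0. Qed.

Let onep (x : R) : 0 < 1 + x `^ q.
Proof. by rewrite ltr_pwDl// powR_ge0. Qed.

Lemma arcsinh_integrand_continuous (x : R) : 0 < x ->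
  {for x, continuous (fun t => (1 + t `^ q) `^ (- p^-1))}.
Proof.
move=> x0; apply: continuous_powR_comp => //.
apply: cvgD; first exact: cvg_cst.
exact: (@continuous_powR_comp _ id).
Qed.

Lemma arcsinh_integrand_within (s : R) :
  {within `[0, s], continuous (fun t => (1 + t `^ q) `^ (- p^-1))}.
Proof.
apply: (@subspace_eq_continuous _ _ _ (fun t => (1 + `|t| `^ q) `^ (- p^-1))).
  by move=> t /set_mem/=; rewrite in_itv/= => /andP[t0 _]; rewrite ger0_norm.
apply: continuous_subspaceT => t.
apply: (@continuous_powR_comp _ (fun t : R => 1 + `|t| `^ q) (- p^-1) t) => //.
by apply: cvgD; [exact: cvg_cst|exact: continuous_norm_powR].
Qed.

Lemma arcsinh_integrable (s : R) :
  (@lebesgue_measure R).-integrable `[0, s]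
    (EFin \o (fun t => (1 + t `^ q) `^ (- p^-1))).
Proof.
apply: continuous_compact_integrable; first exact: segment_compact.
exact: arcsinh_integrand_within.
Qed.

Lemma arccoshE (s : R) : 0 <= s ->
  arccosh_pq p q ((1 + s `^ q) `^ (p^-1)) = arcsinh_pq p q s.
Proof.
have [k ck kE] : exists2 k : R -> R, continuous k &
    forall x, 0 <= x -> k x = (1 + x `^ q) `^ (p^-1).
  exists (fun x => `|1 + `|x| `^ q| `^ (p^-1)) => [|x x0].
    apply: continuous_norm_comp_powR => // x.
    by apply: cvgD; [exact: cvg_cst|exact: continuous_norm_powR].
  by rewrite (ger0_norm x0) (ger0_norm (ltW (onep x))).
move=> s0; rewrite -kE// /arccosh_pq /cosh_pq /sinh_pq_dom.
apply: (@pinv_derive_within_primitive _ `[0, +oo[%classic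
  (fun t => (1 + t `^ q) `^ (- p^-1)) k) => //.
- exact: interval_is_interval.
- by move=> v /=; rewrite in_itv/= andbT.
- by exists 0, 1; rewrite /= !in_itv/= !lexx ler01 eq_sym oner_neq0.
- by move=> v _; exact: arcsinh_integrable.
- move=> v x _ /andP[x0 _]; rewrite kE ?(ltW x0)//; split.
  + exact: arcsinh_integrand_continuous.
  + exact: powR_gt0.
  + by rewrite powRN divff// gt_eqF// powR_gt0.
- move=> x y /set_mem/=; rewrite in_itv/= andbT => x0.
  move=> /set_mem/=; rewrite in_itv/= andbT => y0; rewrite (kE x x0) (kE y y0).
  move/(powR_injective ip0); rewrite !nnegrE !(ltW (onep _)) => /(_ isT isT).
  move/addrI/(powR_injective q0); rewrite !nnegrE; exact.
- by rewrite /= in_itv/= andbT.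
Qed.

Lemma arcsinh_beta_prim (s : R) : 0 <= s ->
  arcsinh_pq p q s = beta_prim p^-1 q^-1 (s `^ q / (1 + s `^ q)).
Proof.
rewrite le_eqVlt => /predU1P[<-|s0]; rewrite /arcsinh_pq.
  rewrite set_itv1 Rintegral_set1 powR0 ?gt_eqF// mul0r.
  by rewrite /beta_prim powR0 ?gt_eqF// !mul0r.
(* The image of [0, +oo[ under this substitution is [0, 1[, where the series
   converges. *)
pose w (x : R) := x `^ q / (1 + x `^ q).
have wE x : 1 - w x = (1 + x `^ q)^-1.
  by rewrite /w; have := onep x => ?; field; rewrite gt_eqF.
apply: (@Rintegral_beta_prim _ _ _ _ _ w
  (fun x => q * x `^ (q - 1) / (1 + x `^ q) ^+ 2)) => //.
- have : p^-1 < 1 by rewrite invf_lt1.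
  by have := iq0; lra.
- exact: arcsinh_integrand_within.
- move=> x /andP[x0 _]; split.
  + by rewrite -(subr_gt0 (w x)) wE invr_gt0 andbC onep divr_gt0 ?powR_gt0.
  + have dy : is_derive x 1 (fun t : R => 1 + t `^ q) (q * x `^ (q - 1)).
      have := is_deriveD (is_derive_cst (1 : R) x 1) (is_derive1_powR q x0).
      by rewrite add0r.
    have y0 : 1 + x `^ q != 0 by rewrite gt_eqF.
    have := is_deriveM (is_derive1_powR q x0)
      (@is_deriveV _ (fun t : R => 1 + t `^ q) x _ 1 y0 dy).
    by move/is_derive_eq; apply; rewrite /GRing.scale/=; field.
  + rewrite wE /w powRM ?powR_ge0 ?invr_ge0 ?(ltW (onep _))//.
    set y := 1 + x `^ q; have y0 : 0 < y by exact: onep.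
    have -> : (y ^+ 2)^-1 = y `^ (- 2%:R) by rewrite powR_invn// ltW.
    rewrite -powRrM -!(powR_inv1 (ltW y0)) -!powRrM.
    have -> : q * (q^-1 - 1) = 1 - q by rewrite mulrBr mulr1 divff// gt_eqF.
    have xE : x `^ (1 - q) * x `^ (q - 1) = 1.
      by rewrite -powRD ?(gt_eqF x0) ?implybT// addrA subrK subrr powRr0.
    have yE : y `^ (-1 * (q^-1 - 1)) * y `^ (-1 * (p^-1 - q^-1 - 1)) * y `^ (- 2%:R)
        = y `^ (- p^-1).
      by rewrite -!powRD ?(gt_eqF y0) ?implybT//; congr (_ `^ _); ring.
    rewrite -yE -[LHS]mul1r -[X in X * _]xE -[X in X * _]mul1r.
    rewrite -[X in X * _ * _](@mulVf _ q) ?gt_eqF//; ring.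
- rewrite -[X in _ --> X](mul0r (1 + 0)^-1).
  apply: cvgM; first exact: powR_cvg0.
  apply: cvgV; first by rewrite addr0 oner_neq0.
  by apply: cvgD; [exact: cvg_cst|exact: powR_cvg0].
- by rewrite /w powR0 ?gt_eqF// mul0r.
Qed.

End arcsinh.

(** * The hypergeometric formulas *)

Theorem lemma1 (R : realType) (p q : R) (hp : 1 < p) (hq : 1 < q) :
  let rhs_cos (x : R) : R :=
    x `^ (p - 1) * (1 - x `^ p) `^ (q^-1)
      * hyp2F1 1 (1 + q^-1 - p^-1) (1 + q^-1) (1 - x `^ p) in
  let rhs_cosh (x : R) : R :=
    x^-1 * (x `^ p - 1) `^ (q^-1)
      * hyp2F1 1 (p^-1) (1 + q^-1) (1 - x `^ (- p)) in
  [/\ forall x : R, 0 < x -> x <= 1 -> arccos_pq p q x = rhs_cos x,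
      rhs_cos x @[x --> 0^'+] --> arccos_pq p q 0
    & forall x : R, 1 <= x -> arccosh_pq p q x = rhs_cosh x].
Proof.
move=> rhs_cos rhs_cosh.
have p0 : 0 < p by exact: lt_trans hp.
have q0 : 0 < q by exact: lt_trans hq.
(* The sine of the angle whose cosine is [x]. *)
pose s (x : R) := (1 - x `^ p) `^ q^-1.
have sq (x : R) : 0 <= x -> x <= 1 -> s x `^ q = 1 - x `^ p.
  move=> x0 x1; rewrite /s -powRrM mulVf ?gt_eqF// powRr1// subr_ge0.
  exact: powR_le1.
have s01 (x : R) : 0 <= x -> x <= 1 -> 0 <= s x <= 1.
  move=> x0 x1; rewrite powR_ge0 powR_le1 ?invr_gt0// ?subr_ge0 ?powR_le1//.
  by rewrite gerBl powR_ge0.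
have acos (x : R) : 0 <= x -> x <= 1 -> arccos_pq p q x = arcsin_pq p q (s x).
  move=> x0 x1; rewrite -(arccosE hp hq (s01 x x0 x1)) sq// opprB addrC subrK.
  by rewrite -powRrM divff ?gt_eqF// powRr1.
have s1 (x : R) : 0 < x -> x <= 1 -> s x < 1.
  move=> x0 x1; rewrite /s powR_lt1 ?invr_gt0// ?subr_ge0 ?powR_le1 ?(ltW x0)//.
  by rewrite gtrBl powR_gt0.
have acosE (x : R) : 0 < x -> x <= 1 -> arccos_pq p q x = rhs_cos x.
  move=> x0 x1; rewrite acos ?(ltW x0)// arcsin_beta_prim ?s1//; last first.
    by have /andP[] := s01 x (ltW x0) x1.
  have xE : x `^ p `^ (1 + q^-1 - p^-1 - q^-1) = x `^ (p - 1).
    by rewrite -powRrM; congr (_ `^ _); field; rewrite !gt_eqF.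
  rewrite sq ?(ltW x0)// /beta_prim /rhs_cos subKr xE.
  by rewrite [_ `^ q^-1 * _]mulrC.
split => //.
- apply: (@cvg_trans _ (arcsin_pq p q (s x) @[x --> 0^'+])).
    apply: near_eq_cvg; near=> x.
    have x0 : 0 < x by near: x; exact: nbhs_right_gt.
    have x1 : x <= 1 by near: x; exact: nbhs_right_le.
    by rewrite -acosE// acos// ltW.
  rewrite acos// {2}/s powR0 ?gt_eqF// subr0 powR1.
  have cs : s x @[x --> 0^'+] --> (1 : R).
    have c1 : 1 - x `^ p @[x --> 0^'+] --> (1 : R).
      rewrite -[X in _ --> X]subr0.
      by apply: cvgB; [exact: cvg_cst|exact: powR_cvg0].
    have c : {for (1 : R), continuous (fun y : R => y `^ q^-1)}.
      exact: (@continuous_powR_comp _ id).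
    by have := cvg_comp _ _ c1 c; rewrite powR1; apply.
  have cs' : s x @[x --> 0^'+] --> 1^'-.
    have near1 : \forall x \near 0^'+, s x < 1.
      near=> x; apply: s1; first by near: x; exact: nbhs_right_gt.
      by near: x; exact: nbhs_right_le.
    by move=> P P1; apply: filterS2 near1 (cs _ P1) => x sx; apply.
  exact: cvg_comp cs' (arcsin_cvg1 hp hq).
- move=> x x1.
  have x0 : 0 < x by exact: lt_le_trans x1.
  have xp : 0 <= x `^ p - 1.
    by rewrite subr_ge0; have := ler_powR x1 (ltW p0); rewrite powRr0.
  have E : (x `^ p - 1) `^ q^-1 `^ q = x `^ p - 1.
    by rewrite -powRrM mulVf ?gt_eqF// powRr1.
  have := @arccoshE _ p q hp hq ((x `^ p - 1) `^ q^-1) (powR_ge0 _ _).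
  rewrite arcsinh_beta_prim ?powR_ge0// E addrC subrK -powRrM divff ?gt_eqF//.
  rewrite powRr1 ?(ltW x0)// => ->.
  have wE : (x `^ p - 1) / x `^ p = 1 - x `^ (- p).
    by rewrite powRN mulrBl mul1r divff// gt_eqF// powR_gt0.
  have w1E : 1 - (x `^ p - 1) / x `^ p = x `^ (- p) by rewrite wE subKr.
  have xE : x `^ (- p) `^ q^-1 * x `^ (- p) `^ (p^-1 - q^-1) = x^-1.
    rewrite -powRD ?(gt_eqF (powR_gt0 _ x0)) ?implybT// addrC subrK -powRrM.
    by rewrite mulNr divff ?gt_eqF// powR_inv1// ltW.
  rewrite /beta_prim /rhs_cosh -wE; set F := hyp2F1 _ _ _ _.
  rewrite w1E powRM ?invr_ge0 ?powR_ge0// -powRN.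
  by rewrite -[X in X * F]mulrA xE [X in X * F]mulrC.
Unshelve. all: by end_near. Qed.
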